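(* Let $c,d$ be coprime positive integers with $1<d/c<2$, and put $h=d-c$. In this range the overlap construction (described in the context) realizes $d/c$ through a two-block overlap, and the size bound it certifies for the resulting poset $R$ is $$|R|\ \le\ 1+s(\ell/c)+s\bigl((h-\ell)/c\bigr)$$ for a choice of $\ell\in\{0,1,\dots,h\}$, while for every such $\ell$, $$s(\ell/c)+s\bigl((h-\ell)/c\bigr)\ \ge\ \Bigl\lfloor \frac{c}{h}\Bigr\rfloor.$$ Consequently the construction certifies the bound $\nu(c,d)\le d/c+O(\log d\log\log d)$ only when $h=\Omega\bigl(c/(\log c\log\log c)\bigr)$. If $h/c\to 0$ faster than this inverse-polylogarithmic rate, then no choice of parameters lets the construction certify the bound, and the hypothesis $d\ge(1+\varepsilon)c$ (in the theorem, recalled in the context, that the construction is used to prove) cannot be removed by this construction alone.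
   Context: For a finite poset $P$, $e(P)$ is the number of linear extensions of $P$, with $e(\varnothing)=1$. For $x\in P$, $P-x$ is the induced subposet on the remaining elements, and $\rho(P,x):=e(P)/e(P-x)$. $\operatorname{Min}(P)$ is the set of minimal elements of $P$, and $P^*$ is the dual poset. For positive integers $c\le d$, $\nu(c,d)$ is the least $|P|$ over finite posets $P$ having some $x\in P$ with $\rho(P,x)=d/c$. For integers $0\le m<b$, $s(m/b)$ is the sum of the partial quotients in the simple continued fraction of the rational number $m/b$, with $s(0)=0$; it depends only on the rational value, and $m/b$ need not be in lowest terms. The theorem whose hypothesis is discussed: for every fixed $\varepsilon>0$, $\nu(c,d)\le d/c+O_\varepsilon(\log d\log\log d)$ for all positive integers $c,d$ with $d\ge(1+\varepsilon)c$. In the range $1<d/c<2$ it is proved by the following construction. Ingredient (Chan and Pak): for integers $K\ge1$, $b\ge1$, $0\le m<b$ there are a finite poset $P$ and $x\in\operatorname{Min}(P)$ with $\rho(P,x)=K+m/b$ and $|P|\le K+s(m/b)$. Ingredient (overlap of two blocks): given finite posets $P$ on $X$ and $Q$ on $Y$ with $X\cap Y=\varnothing$, $x\in\operatorname{Min}(P)$, $y\in\operatorname{Min}(Q)$, let $R$ be the poset on $(X\setminus\{x\})\sqcup(Y\setminus\{y\})\sqcup\{z\}$, with $z$ a new element, generated under transitive closure by: the order of $P^*-x$ on $X\setminus\{x\}$ and the order of $Q-y$ on $Y\setminus\{y\}$; $u\prec_R w$ for all $u\in X\setminus\{x\}$, $w\in Y\setminus\{y\}$; $p\prec_R z$ whenever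 $x\prec_P p$; $z\prec_R q$ whenever $y\prec_Q q$. Then $|R|=|P|+|Q|-1$ and $\rho(R,z)=\rho(P,x)+\rho(Q,y)-1$. The overlap construction for coprime $c,d$ with $1<d/c<2$, $h=d-c$: choose some $\ell\in\{0,1,\dots,h\}$ (in the proof of the theorem, for $h\ge\varepsilon c$ and $c$ large, $\ell$ is chosen so that $s(\ell/c)$ and $s((h-\ell)/c)$ are both $O(\log c\log\log c)$; for the remaining small $c$, $\ell=0$); use the first ingredient to get $P,x$ with $\rho(P,x)=1+\ell/c$, $|P|\le 1+s(\ell/c)$, and $Q,y$ with $\rho(Q,y)=1+(h-\ell)/c$, $|Q|\le 1+s((h-\ell)/c)$; and form the overlap $R,z$ of these two blocks, so that $\rho(R,z)=d/c$. The size bound the construction certifies is the one obtained from these bounds on $|P|$ and $|Q|$ together with $|R|=|P|+|Q|-1$. The choice of $\ell$ is its only free parameter. *)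

(* Defs.v *)
From HB Require Import structures.
From mathcomp Require Import all_boot all_order all_algebra.
From mathcomp Require Import boolp classical_sets cardinality reals exp.
Set Implicit Arguments.
Unset Strict Implicit.
Unset Printing Implicit Defensive.
Import Order.TTheory GRing.Theory Num.Theory.

Local Open Scope ring_scope.

(* [lin_ext f]: listing P by increasing values of the bijection f gives a
   linear extension of P. *)
Definition lin_ext d (P : finPOrderType d) (f : {ffun P -> 'I_#|P|}) : bool :=
  injectiveb f && [forall u, forall v, (u < v)%O ==> (f u < f v)%N].

Definition nb_linext d (P : finPOrderType d) : nat := #|@lin_ext d P|.

Definition Min d (P : finPOrderType d) : {set P} :=
  [set x | [forall u : P, ~~ (u < x)%O]].

(* The induced subposet P - x. *)
Definition del d (P : finPOrderType d) (x : P) : Type := {u : P | u != x}.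

HB.instance Definition _ d (P : finPOrderType d) (x : P) :=
  SubFinite.on (del x).
HB.instance Definition _ d (P : finPOrderType d) (x : P) :=
  [SubChoice_isSubPOrder of del x by <: with d].

Definition rho d (P : finPOrderType d) (x : P) : rat :=
  (nb_linext P)%:R / (nb_linext (del x))%:R.

Definition realized (c d n : nat) : Prop :=
  exists (disp : Order.disp_t) (P : finPOrderType disp) (x : P),
    #|P| = n /\ rho x = d%:R / c%:R.

(* The default value 0 of xget is taken only if no finite poset realizes d/c. *)
Definition nu (c d : nat) : nat :=
  xget 0%N [set n | realized c d n /\ forall k, realized c d k -> (n <= k)%N].

(* Partial quotients of the simple continued fraction of q >= 0. The
   denominators of the successive complete quotients strictly decrease, so
   that `|denq q| steps are enough. *)
Fixpoint cfrac (fuel : nat) (q : rat) : seq nat :=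
  if fuel is n.+1 then
    let a := Num.truncn q in
    a :: (if q == a%:R then [::] else cfrac n (q - a%:R)^-1)
  else [::].

Definition s (q : rat) : nat := sumn (cfrac `|denq q|%N q).

Definition block_bound (K m b : nat) : nat := (K + s (m%:R / b%:R))%N.

Definition is_block (K m b : nat) d (P : finPOrderType d) (x : P) : Prop :=
  [/\ x \in Min P, rho x = K%:R + m%:R / b%:R & (#|P| <= block_bound K m b)%N].

Section Overlap.
Variables (d1 d2 : Order.disp_t) (P : finPOrderType d1) (Q : finPOrderType d2).
Variables (x : P) (y : Q).

(* [Some (inl u)] is u in X \ {x} (with the dual order), [Some (inr w)] is w in
   Y \ {y}, and [None] is the new element z. *)
Definition overlap : Type := option (del (x : P^d) + del y).

HB.instance Definition _ := Finite.on overlap.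

Definition overlap_pt : overlap := None.

Definition overlap_gen : rel overlap := fun a b =>
  match a, b with
  | Some (inl u), Some (inl v) => (u < v)%O
  | Some (inr v), Some (inr w) => (v < w)%O
  | Some (inl _), Some (inr _) => true
  | Some (inl p), None => (x < (val p : P))%O
  | None, Some (inr q) => (y < val q)%O
  | _, _ => false
  end.

Definition overlap_le : rel overlap := connect overlap_gen.

Lemma overlap_gen_irr a : ~~ overlap_gen a a.
Proof. by case: a => [[u|w]|] //=; rewrite ltxx. Qed.

Lemma overlap_gen_trans : transitive overlap_gen.
Proof.
move=> [[v|v]|] [[u|u]|] [[w|w]|] //=; try exact: lt_trans.
all: by move=> vu xv; apply: lt_trans xv vu.
Qed.

Lemma overlap_leE a b : overlap_le a b = (a == b) || overlap_gen a b.
Proof.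
apply/idP/idP; last first.
  by case/orP=> [/eqP->|ab]; [exact: connect0 | exact: connect1].
case/connectP=> p; elim: p a => [|a' p IHp] a /=; first by move=> _ ->; rewrite eqxx.
move=> /andP[aa' pp] bE; have /orP[/eqP<-|a'b] := IHp _ pp bE.
  by rewrite aa' orbT.
by rewrite (overlap_gen_trans aa' a'b) orbT.
Qed.

Lemma overlap_le_refl : reflexive overlap_le.
Proof. exact: connect0. Qed.

Lemma overlap_le_trans : transitive overlap_le.
Proof. exact: connect_trans. Qed.

Lemma overlap_le_anti : antisymmetric overlap_le.
Proof.
move=> a b; rewrite !overlap_leE.
move=> /andP[/orP[/eqP //|ab] /orP[/eqP //|ba]].
by have := overlap_gen_irr a; rewrite (overlap_gen_trans ab ba).
Qed.

HB.instance Definition _ := Order.Le_isPOrder.Build d1 overlap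
  overlap_le_refl overlap_le_anti overlap_le_trans.

End Overlap.

Definition admissible : set (nat * nat) :=
  [set p | [/\ (0 < p.1)%N, coprime p.1 p.2 & (p.1 < p.2 < 2 * p.1)%N]].

(* The size bound certified for the overlap of two blocks realizing 1 + l/c and
   1 + (h - l)/c, where h = d - c: it combines |R| = |P| + |Q| - 1 with the
   bounds on |P| and |Q|. *)
Definition overlap_bound (c d l : nat) : nat :=
  (block_bound 1 l c + block_bound 1 (d - c - l) c - 1)%N.

Section Rates.
Variable R : realType.

Definition certifies (c d : nat) (B : R) : Prop :=
  exists2 l : nat, (l <= d - c)%N & (overlap_bound c d l)%:R <= B.

Definition log_loglog (n : nat) : R := ln n%:R * ln (ln n%:R).

(* The construction certifies nu(c, d) <= d/c + O(log d loglog d) for (c, d)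
   ranging over S, the implied constant being uniform over S. *)
Definition certifies_O (S : set (nat * nat)) : Prop :=
  exists (C : R) (N : nat), forall c d, S (c, d) -> (N <= d)%N ->
    certifies c d (d%:R / c%:R + C * log_loglog d).

(* d - c = Omega(c / (log c loglog c)) over S. *)
Definition gap_Omega (S : set (nat * nat)) : Prop :=
  exists2 k : R, 0 < k & exists N : nat, forall c d, S (c, d) -> (N <= c)%N ->
    k * (c%:R / log_loglog c) <= (d - c)%:R.

(* (d - c) / c = o(1 / (log c loglog c)) over S. *)
Definition gap_o (S : set (nat * nat)) : Prop :=
  forall k : R, 0 < k -> exists N : nat, forall c d, S (c, d) -> (N <= c)%N ->
    (d - c)%:R / c%:R <= k * (log_loglog c)^-1.

End Rates.

(* Main.v *)
(* Counting linear extensions by their first element turns every identity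
   between numbers e(-) into an induction over the finite subsets of a poset.

   Blocks: add to P a new element z below everything except the minimal element
   x. Then e(P + z) = e(P) + e(P - x), so the quotient at x becomes rho(P, x) + 1
   and the quotient at z is 1 + 1 / rho(P, x). These are the two steps of the
   continued fraction, each at the cost of one element.

   Overlap: with L, U the lower and upper parts, e(L + z + U) + e(L) e(U) =
   e(L + z) e(U) + e(L) e(z + U).

   Lower bound: for l > 0 the first partial quotient of c / l is at least
   floor(c / h), and for l = 0 the fraction h / c contributes floor(c / h). So a
   certified bound d/c + O(log d loglog d) forces c / h = O(log c loglog c), which
   fails for instance when h = 1. *)
Require Import Defs.
From HB Require Import structures.
From mathcomp Require Import boolp classical_sets cardinality reals sequences exp.
From mathcomp Require Import all_boot all_order all_algebra.
From mathcomp Require Import ring lra zify.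
Set Implicit Arguments.
Unset Strict Implicit.
Unset Printing Implicit Defensive.
Import Order.TTheory GRing.Theory Num.Theory.

(** * Listings of a finite relation *)

Section Listings.
Variables (T : finType) (r : rel T).

Definition minset (A : {set T}) : {set T} :=
  [set x in A | [forall y in A, ~~ r y x]].

(** The fuel [n] is meant to be [#|A|], because [A :\ x] is not structurally smaller than [A]. Each
    step chooses the element that comes first. *)
Fixpoint listings n (A : {set T}) : seq (seq T) :=
  if n is n'.+1 then
    [seq x :: t | x <- enum (minset A), t <- listings n' (A :\ x)]
  else [:: [::]].

(** For a strict order [r] this is e of the order induced on [A]. Ranging over subsets of one fixed
    type lets inductions delete points without changing the type. *)
Definition nle (A : {set T}) : nat := size (listings #|A| A).

Lemma minsetP (A : {set T}) x :
  reflect (x \in A /\ forall y, y \in A -> ~~ r y x) (x \in minset A).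
Proof. by rewrite inE; apply: (iffP andP) => -[xA /forall_inP]. Qed.

Lemma minset_sub (A : {set T}) x : x \in minset A -> x \in A.
Proof. by case/minsetP. Qed.

Lemma nle0 : nle set0 = 1.
Proof. by rewrite /nle cards0. Qed.

Lemma nle_rec (A : {set T}) : A != set0 ->
  nle A = \sum_(x in minset A) nle (A :\ x).
Proof.
rewrite -card_gt0 {1}/nle => A0.
rewrite -(prednK A0) /= size_allpairs_dep sumnE big_map -[RHS]big_enum /=.
rewrite [LHS]big_seq [RHS]big_seq; apply: eq_bigr => x.
rewrite mem_enum => /minset_sub xA; rewrite /nle.
by rewrite (cardsD1 x A) xA.
Qed.

Lemma listings_uniq n (A : {set T}) : uniq (listings n A).
Proof.
elim: n A => [//|n IHn] A /=; apply: allpairs_uniq_dep.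
- exact: enum_uniq.
- by move=> x _; apply: IHn.
- by move=> [x t] [y t'] _ _ /= [-> ->].
Qed.

Hypothesis r_irr : irreflexive r.

Lemma mem_listings n (A : {set T}) t : #|A| = n ->
  t \in listings n A <->
  [/\ uniq t, t =i A & pairwise (fun u v => ~~ r v u) t].
Proof.
elim: n A t => [|n IHn] A t cA /=.
  have /eqP A0 : A == set0 by rewrite -cards_eq0 cA.
  rewrite inE A0; split=> [/eqP->|[_ tA _]]; first by split=> // u; rewrite inE.
  by case: t tA => [//|u t] /(_ u); rewrite !inE eqxx.
have cD x : x \in A -> #|A :\ x| = n.
  by move=> xA; move: cA; rewrite (cardsD1 x) xA => -[].
split=> [/allpairsPdep[x [t' [xm t'L ->]]]|].
  move: xm; rewrite mem_enum => /minsetP[xA xmin].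
  have [ut' t'A pt'] := (IHn _ _ (cD _ xA)).1 t'L.
  split.
  - by rewrite /= ut' t'A !inE eqxx.
  - by move=> u; rewrite inE t'A !inE; case: eqP => [->|].
  - by rewrite /= pt' andbT; apply/allP=> u; rewrite t'A => /setD1P[_ /xmin].
case: t => [|x t] [ut tA pt].
  by move: cA; rewrite (_ : A = set0) ?cards0 //; apply/setP=> u; rewrite -tA inE.
have xA : x \in A by rewrite -tA mem_head.
move: ut pt => /= /andP[xt ut] /andP[/allP px pt].
apply/allpairsPdep; exists x, t; split=> //.
  rewrite mem_enum; apply/minsetP; split=> // y; rewrite -tA inE.
  by case: eqP => [-> _|_ /px //]; rewrite r_irr.
apply/(IHn _ _ (cD _ xA)); split=> // u; rewrite !inE -tA inE.
by case: eqP => [->|//]; rewrite (negPf xt).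
Qed.

Hypothesis r_trans : transitive r.

(** An element of [A] with the fewest predecessors is minimal: by transitivity a predecessor [y] of
    [x] has all its predecessors below [x], and [y] itself is no longer counted. *)
Lemma minset_neq0 (A : {set T}) : A != set0 -> minset A != set0.
Proof.
case/set0Pn=> a aA.
have [x xA xmin] := arg_minnP (fun u => #|[set v | r v u]|) aA.
apply/set0Pn; exists x; apply/minsetP; split=> // y yA; apply/negP=> ryx.
have := xmin _ yA; rewrite leqNgt => /negP; apply; apply: proper_card.
apply/properP; split; first by apply/subsetP=> v; rewrite !inE => /r_trans; apply.
by exists y; rewrite !inE ?r_irr.
Qed.

Lemma nle_gt0 (A : {set T}) : 0 < nle A.
Proof.
have [n] := ubnP #|A|; elim: n A => [//|n IHn] A An.
have [->|A0] := eqVneq A set0; first by rewrite nle0.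
rewrite nle_rec //; have /set0Pn[x xm] := minset_neq0 A0.
rewrite (bigD1 x) //= addn_gt0 IHn //.
by move: An; rewrite (cardsD1 x) (minset_sub xm).
Qed.

(* The linear extensions are the functions [u |-> index u t] for t a listing of
   the whole type. *)
Lemma card_linext_nle :
  #|[pred f : {ffun T -> 'I_#|T|} | injectiveb f &&
       [forall u, forall v, r u v ==> (f u < f v)]]| = nle setT.
Proof.
set L := listings #|[set: T]| [set: T].
have LP t : t \in L <-> [/\ uniq t, t =i [set: T] & pairwise (fun u v => ~~ r v u) t].
  exact: mem_listings.
have szL t : t \in L -> size t = #|T|.
  case/LP=> ut tT _; rewrite -(card_uniqP ut) -cardsT; apply: eq_card => u.
  by rewrite tT.
have inL t u : t \in L -> u \in t by case/LP=> _ -> _; rewrite inE.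
(* The default [enum_rank u] is never reached for [t] in [L], since such a [t] contains every
   [u]. *)
pose ext (t : seq T) : {ffun T -> 'I_#|T|} :=
  [ffun u => odflt (enum_rank u) (insub (index u t))].
have extE t u : t \in L -> ext t u = index u t :> nat.
  move=> tL; rewrite ffunE insubT; first by rewrite -(szL t) // index_mem inL.
  by [].
have ext_inj : {in L &, injective ext}.
  move=> t t' tL t'L /ffunP ett'.
  have idx u : index u t = index u t' by rewrite -!extE ?ett'.
  case: (LP t) => /(_ tL)[ut _ _] _.
  (* Comparing listings entry by entry needs a default element, so an empty [T] is treated apart. *)
  have [x0|T0] := pickP (@predT T); last first.
    have nilL u : u \in L -> u = [::] by case: u => // x u; have := T0 x.
    by rewrite (nilL t tL) (nilL t' t'L).
  move=> _; apply: (@eq_from_nth _ x0) => [|i it]; first by rewrite !szL.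
  by rewrite -[in RHS](index_uniq x0 it ut) idx nth_index ?inL.
rewrite /nle -/L -(size_map ext) -(card_uniqP _); last first.
  by rewrite map_inj_in_uniq ?listings_uniq.
apply: eq_card => f; rewrite !inE; apply/andP/mapP; last first.
  case=> t tL ->; case: (LP t) => /(_ tL)[ut _ pt] _; split.
    apply/injectiveP => u v /(congr1 val) /=; rewrite !extE // => iuv.
    by rewrite -(nth_index u (inL t u tL)) iuv nth_index ?inL.
  apply/forallP=> u; apply/forallP=> v; apply/implyP=> ruv.
  rewrite !extE // ltnNge leq_eqVlt; apply/norP; split.
    apply/eqP=> ivu; move: ruv; rewrite -(nth_index u (inL t v tL)) ivu.
    by rewrite nth_index ?inL // r_irr.
  apply/negP=> ivu; have/(pairwiseP u)/(_ (index v t) (index u t)) := pt.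
  by rewrite !inE !index_mem !inL // !nth_index ?inL // ruv => /(_ isT isT ivu).
case=> /injectiveP f_inj /forallP f_mono.
have [g fK gK] : bijective f by apply: inj_card_bij; rewrite ?card_ord.
(* The listing behind [f] is its inverse read along the positions in increasing order. *)
pose t := [seq g i | i <- enum 'I_#|T|].
have ut : uniq t by rewrite map_inj_uniq ?enum_uniq //; exact: can_inj gK.
have tT u : u \in t by rewrite -(fK u) map_f ?mem_enum.
have tL : t \in L.
  apply/LP; split=> //; first by move=> u; rewrite tT inE.
  rewrite pairwise_map; apply: (@sub_pairwise _ (fun i j : 'I_#|T| => i < j)).
    move=> i j ij /=; apply/negP=> rgji.
    have /forallP/(_ (g i))/implyP/(_ rgji) := f_mono (g j).
    by rewrite !gK ltnNge ltnW.
  rewrite -(@pairwise_map _ _ val ltn) val_enum_ord -sorted_pairwise ?iota_ltn_sorted //.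
  exact: ltn_trans.
exists t => //; apply/ffunP=> u; apply/val_inj; rewrite /= extE //.
by rewrite -{2}(fK u) index_map ?index_enum_ord //; exact: can_inj gK.
Qed.
End Listings.

(** Both conditions on [h] are restricted to [A], so that [h] may take arbitrary values elsewhere;
    the maps out of an overlap rely on this. *)
Lemma nle_imset (T T' : finType) (r : rel T) (r' : rel T') (h : T -> T')
    (A : {set T}) :
  {in A &, injective h} -> {in A &, {mono h : x y / r x y >-> r' x y}} ->
  nle r' (h @: A) = nle r A.
Proof.
have [n] := ubnP #|A|; elim: n A => [//|n IHn] A An h_inj h_mono.
have [->|A0] := eqVneq A set0; first by rewrite imset0 !nle0.
have mE : minset r' (h @: A) = h @: minset r A.
  apply/setP=> y; apply/minsetP/imsetP=> [[/imsetP[x xA ->] xmin]|[x xm ->]].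
    exists x => //; apply/minsetP; split=> // z zA.
    by rewrite -h_mono // xmin // imset_f.
  have [xA xmin] := minsetP _ _ _ xm; split; first exact: imset_f.
  by move=> _ /imsetP[z zA ->]; rewrite h_mono // xmin.
have sub := @minset_sub _ r A.
rewrite !nle_rec ?imset_eq0 // mE big_imset /=; last first.
  by move=> u v /sub uA /sub vA; apply: h_inj.
apply: eq_bigr => x /sub xA.
have <- : h @: (A :\ x) = h @: A :\ h x.
  apply/setP=> y; apply/imsetP/setD1P=> [[z /setD1P[zx zA] ->]|].
    by rewrite imset_f //; split=> //; apply: contra_neq zx => /h_inj; apply.
  case=> yx /imsetP[z zA yE]; exists z => //; rewrite !inE zA andbT.
  by apply: contraNneq yx => <-; rewrite yE.
apply: IHn; first by move: An; rewrite (cardsD1 x) xA.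
  by move=> u v /setD1P[_ uA] /setD1P[_ vA]; apply: h_inj.
by move=> u v /setD1P[_ uA] /setD1P[_ vA]; apply: h_mono.
Qed.

(** * Counting identities: ordinal sums, an added bottom element, overlaps *)

Section Sums.
Variables (T : finType) (r : rel T).
Hypotheses (r_irr : irreflexive r) (r_trans : transitive r).
Implicit Types A B : {set T}.

Lemma nle1 x : nle r [set x] = 1.
Proof.
rewrite nle_rec; last by apply/set0Pn; exists x; rewrite inE.
have -> : minset r [set x] = [set x].
  apply/setP=> y; apply/minsetP/idP=> [[]|/set1P->] //.
  by rewrite inE eqxx; split=> // z /set1P->; rewrite r_irr.
by rewrite big_set1 setDv nle0.
Qed.

(** As long as [A] is nonempty, the minimal elements of the union are those of [A]; the recursion
    thus uses up [A] before it touches [B]. *)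
Lemma nle_ordsum A B : (forall a b, a \in A -> b \in B -> r a b) ->
  nle r (A :|: B) = nle r A * nle r B.
Proof.
have [n] := ubnP #|A|; elim: n A => [//|n IHn] A An rAB.
have [->|A0] := eqVneq A set0; first by rewrite set0U nle0 mul1n.
have AB0 : A :|: B != set0 by rewrite setU_eq0 (negPf A0).
have mE : minset r (A :|: B) = minset r A.
  apply/setP=> y; apply/minsetP/minsetP=> -[].
    case/setUP=> [yA|yB] ymin.
      by split=> // z zA; apply: ymin; rewrite inE zA.
    have /set0Pn[a aA] := A0.
    by have := ymin a; rewrite inE aA rAB // => /(_ isT).
  move=> yA ymin; split; first by rewrite inE yA.
  move=> z /setUP[/ymin//|zB]; apply/negP=> rzy.
  by have := r_trans rzy (rAB _ _ yA zB); rewrite r_irr.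
rewrite (nle_rec _ AB0) (nle_rec _ A0) mE big_distrl; apply: eq_bigr => x /minset_sub xA /=.
have -> : (A :|: B) :\ x = (A :\ x) :|: B.
  rewrite setDUl; congr (_ :|: _); apply/setDidPl; rewrite disjoint_sym disjoints1.
  by apply/negP=> /(rAB _ _ xA); rewrite r_irr.
apply: IHn; first by move: An; rewrite (cardsD1 x) xA.
by move=> a b /setD1P[_]; apply: rAB.
Qed.

(** Only [z] and [x] can come first. Starting with [z] leaves [A]; starting with [x] leaves [z]
    below all of [A :\ x], which is an ordinal sum with a single point. *)
Lemma nle_add_bottom z x A : x \in minset r A ->
    (forall a, a \in A -> r z a = (a != x)) -> (forall a, a \in A -> ~~ r a z) ->
    z \notin A ->
  nle r (z |: A) = nle r A + nle r (A :\ x).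
Proof.
move=> xm rz rz' zA; have [xA xmin] := minsetP _ _ _ xm.
have zx : z != x by apply: contraNneq zA => ->.
have mE : minset r (z |: A) = [set z; x].
  apply/setP=> y; apply/minsetP/idP=> [[/setU1P[->|yA] ymin]|].
  - by rewrite !inE eqxx.
  - by have := ymin z; rewrite !inE eqxx rz // negbK => /(_ isT)->; rewrite orbT.
  - case/set2P=> ->.
      by rewrite !inE eqxx; split=> // w /setU1P[->|/rz'//]; rewrite r_irr.
    rewrite !inE xA orbT; split=> // w /setU1P[->|/xmin//].
    by rewrite rz // eqxx.
rewrite nle_rec; last by apply/set0Pn; exists z; rewrite !inE eqxx.
rewrite mE big_setU1 ?inE //= big_set1 setU1K //; congr (_ + _).
have -> : (z |: A) :\ x = [set z] :|: (A :\ x).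
  by rewrite setDUl; congr (_ :|: _); apply/setDidPl; rewrite disjoints1 inE.
rewrite nle_ordsum ?nle1 ?mul1n // => a b /set1P-> /setD1P[bx bA].
by rewrite rz.
Qed.

(* In a linear extension of L + z + U, either z precedes all of U or it follows
   all of L; both happen for [nle r L * nle r U] of them. *)
Lemma nle_overlap z (L U : {set T}) :
    (forall a b, a \in L -> b \in U -> r a b) ->
    (forall a, a \in L -> ~~ r z a) -> (forall b, b \in U -> ~~ r b z) ->
    z \notin L -> z \notin U ->
  nle r (z |: (L :|: U)) + nle r L * nle r U =
  nle r (z |: L) * nle r U + nle r L * nle r (z |: U).
Proof.
have [n] := ubnP #|L|; elim: n L => [//|n IHn] L Ln rLU zL zU zNL zNU.
have [->|L0] := eqVneq L set0.
  by rewrite set0U setU0 nle0 nle1 !mul1n addnC.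
have LU0 : L :|: U != set0 by rewrite setU_eq0 (negPf L0).
have z0 A : z |: A != set0 by apply/set0Pn; exists z; rewrite !inE eqxx.
pose zmin := [forall a in L, ~~ r a z].
(* While [L] is nonempty nothing in [U] can come first, and [z] can exactly when [zmin] holds. The
   statement is used with [A] equal to [U] and to the empty set. *)
have mE A : A \subset U -> minset r (z |: (L :|: A)) =
    if zmin then z |: minset r L else minset r L.
  move=> /subsetP AU; apply/setP=> y.
  transitivity ((y == z) && zmin || (y \in minset r L)); last first.
    case: ifP => _; first by rewrite andbT !inE.
    by rewrite andbF.
  apply/minsetP/orP=> [[/setU1P[->|/setUP[yL|yA]] ymin]|].
  - left; rewrite eqxx; apply/forall_inP=> a aL.
    by apply: ymin; rewrite !inE aL orbT.
  - right; apply/minsetP; split=> // a aL.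
    by apply: ymin; rewrite !inE aL orbT.
  - have /set0Pn[a aL] := L0; have := ymin a.
    by rewrite !inE aL orbT rLU ?AU // => /(_ isT).
  case=> [/andP[/eqP-> /forall_inP zm]|/minsetP[yL ymin]].
    rewrite !inE eqxx; split=> // a /setU1P[->|/setUP[/zm//|/AU/zU//]].
    by rewrite r_irr.
  rewrite !inE yL orbT; split=> // a /setU1P[->|/setUP[/ymin//|/AU aU]].
    exact: zL.
  by apply/negP=> ray; have := r_trans ray (rLU _ _ yL aU); rewrite r_irr.
have sumE A : A \subset U -> nle r (z |: (L :|: A)) =
    zmin * nle r (L :|: A) + \sum_(m in minset r L) nle r (z |: ((L :\ m) :|: A)).
  move=> AU; rewrite (nle_rec _ (z0 _)) (mE _ AU).
  have -> : \sum_(m in minset r L) nle r (z |: ((L :\ m) :|: A)) =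
            \sum_(m in minset r L) nle r ((z |: (L :|: A)) :\ m).
    apply: eq_bigr => m /minset_sub mL; congr nle.
    have mz : m != z by apply: contraNneq zNL => <-.
    apply/setP=> y; rewrite !inE; have [->|ym] //= := eqVneq y m.
    rewrite (negPf mz) /=; apply/negbTE/negP=> /(subsetP AU) mU.
    by have := rLU _ _ mL mU; rewrite r_irr.
  case: (zmin); last by rewrite mul0n.
  rewrite big_setU1; last by apply: contra zNL => /minset_sub.
  rewrite mul1n setU1K // inE (negPf zNL) /=.
  by apply: contra zNU => /(subsetP AU).
have sumE0 : nle r (z |: L) =
    zmin * nle r L + \sum_(m in minset r L) nle r (z |: (L :\ m)).
  rewrite -{1 2}[L]setU0 sumE ?sub0set // setU0.
  by congr (_ + _); apply: eq_bigr => m _; rewrite setU0.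
(* The terms in which [z] comes first agree on both sides; for every other first element [m] what
   remains is the induction hypothesis at [L :\ m]. *)
rewrite sumE // sumE0 (nle_ordsum rLU) (nle_rec _ L0).
rewrite mulnDl -mulnA -!addnA; congr (_ + _).
rewrite !big_distrl -!big_split /=; apply: eq_bigr => m /minset_sub mL.
apply: IHn => //; first by move: Ln; rewrite (cardsD1 m) mL.
- by move=> a b /setD1P[_]; apply: rLU.
- by move=> a /setD1P[_ /zL].
- by rewrite inE negb_and zNL orbT.
Qed.
End Sums.

(** * Duality, and linear extensions of finite posets *)

(** The recursion on first elements is not symmetric under duality, so the proof goes through linear
    extensions as functions, where [rev_ord] on the values reverses the order. *)
Lemma nle_dualT (T : finType) (r : rel T) : irreflexive r ->
  nle (fun u v => r v u) [set: T] = nle r [set: T].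
Proof.
move=> r_irr; rewrite -(card_linext_nle r_irr).
rewrite -(@card_linext_nle _ (fun u v => r v u)); last by move=> u; apply: r_irr.
pose rev (f : {ffun T -> 'I_#|T|}) : {ffun T -> 'I_#|T|} := [ffun u => rev_ord (f u)].
have revK : involutive rev by move=> f; apply/ffunP=> u; rewrite !ffunE rev_ordK.
rewrite -(card_image (inv_inj revK)); apply: eq_card => f.
rewrite -{1}[f]revK (mem_image (inv_inj revK)) !inE; congr (_ && _).
  apply/injectiveP/injectiveP=> f_inj u v; last by rewrite !ffunE => /rev_ord_inj/f_inj.
  by move=> fuv; apply: f_inj; rewrite !ffunE fuv.
apply/'forall_forallP/'forall_forallP=> f_mono u v; apply/implyP=> uv;
  have := implyP (f_mono v u) uv; rewrite !ffunE /= ltn_sub2lE //; exact: ltn_ord.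
Qed.

(** Viewed in the subtype of its elements, [A] becomes a full set, to which [nle_dualT] applies. *)
Lemma nle_dual (T : finType) (r : rel T) (A : {set T}) : irreflexive r ->
  nle (fun u v => r v u) A = nle r A.
Proof.
move=> r_irr; have -> : A = [set val u | u in [set: {u | u \in A}]].
  apply/setP=> u; apply/idP/imsetP=> [uA|[v _ ->]]; last exact: (valP v).
  by exists (Sub u uA).
have val_injA : {in [set: {u | u \in A}] &, injective val}.
  by move=> u v _ _; apply: val_inj.
rewrite (@nle_imset _ _ (fun u v => r (val v) (val u)) (fun u v => r v u)) //.
rewrite (@nle_imset _ _ (fun u v => r (val u) (val v)) r) //.
exact: (@nle_dualT _ (fun u v => r (val u) (val v))).
Qed.

Section NbLinext.
Variables (d : Order.disp_t) (P : finPOrderType d).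
Local Notation lt := (fun u v : P => (u < v)%O).

Lemma nb_linextE : nb_linext P = nle lt [set: P].
Proof. by rewrite -(card_linext_nle (@ltxx _ P)); apply: eq_card. Qed.

Lemma nb_linext_gt0 : 0 < nb_linext P.
Proof. by rewrite nb_linextE; apply: nle_gt0 => [u|]; [apply: ltxx | apply: lt_trans]. Qed.

End NbLinext.
Lemma nb_linext_del d (P : finPOrderType d) (x : P) :
  nb_linext (del x) = nle (fun u v : P => (u < v)%O) ([set: P] :\ x).
Proof.
rewrite nb_linextE -(@nle_imset _ _ _ (fun u v : P => (u < v)%O) val).
- congr nle; apply/setP=> y; rewrite !inE andbT; apply/imsetP/idP=> [[u _ ->]|yx].
    exact: (valP u).
  by exists (Sub y yx).
- by move=> u v _ _; apply: val_inj.
- by [].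
Qed.

(** * Overlaps *)

Section OverlapRho.
Variables (d1 d2 : Order.disp_t) (P : finPOrderType d1) (Q : finPOrderType d2).
Variables (x : P) (y : Q).
Local Notation O := (overlap x y).
Local Notation r := (fun u v : O => (u < v)%O).

(** The generating relation is already transitive and irreflexive, so its closure adds only the
    diagonal. *)
Lemma overlap_ltE (u v : O) : (u < v)%O = overlap_gen u v.
Proof.
rewrite lt_def (_ : (u <= v)%O = overlap_le u v) // overlap_leE.
have [->|] := eqVneq v u; first by rewrite (negPf (overlap_gen_irr _)).
by [].
Qed.

Definition lower_part : {set O} := [set u : O | if u is Some (inl _) then true else false].
Definition upper_part : {set O} := [set u : O | if u is Some (inr _) then true else false].

Lemma overlap_setT :
  [set: O] = overlap_pt x y |: (lower_part :|: upper_part).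
Proof. by apply/setP=> -[[u|u]|]; rewrite !inE. Qed.

Lemma card_overlap : (#|{: O}| = #|P| + #|Q| - 1)%N.
Proof.
have cE d (T : finPOrderType d) (u : T) : #|{: del u}| = #|T|.-1.
  by rewrite card_sig -(cardC1 u); apply: eq_card => v; rewrite !inE.
have := cE _ _ (x : P^d); have := cE _ _ y.
rewrite card_option card_sum => -> ->.
have pos d (T : finPOrderType d) (u : T) : (0 < #|T|)%N by apply/card_gt0P; exists u.
have : (0 < #|P|)%N := pos _ _ x; have : (0 < #|Q|)%N := pos _ _ y.
have arith p q : (0 < q)%N -> (0 < p)%N -> (p.-1 + q.-1).+1 = (p + q - 1)%N by lia.
exact: arith.
Qed.

Hypotheses (xmin : x \in Min P) (ymin : y \in Min Q).

Let gt_x u : (u < x)%O = false.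
Proof. by move: xmin; rewrite inE => /forallP/(_ u)/negbTE. Qed.

Let gt_y u : (u < y)%O = false.
Proof. by move: ymin; rewrite inE => /forallP/(_ u)/negbTE. Qed.

Lemma nle_lower : nle r lower_part = nb_linext (del x).
Proof.
(* The value [x] is a dummy here: [lower_part] contains neither the new point nor the upper
   elements. *)
pose h (u : O) : P := if u is Some (inl v) then val v else x.
rewrite nb_linext_del -(nle_dual _ (@ltxx _ P)).
rewrite -(@nle_imset _ _ r (fun u v : P => (v < u)%O) h).
- congr nle; apply/setP=> u; rewrite !inE andbT.
  apply/imsetP/idP=> [[w wA ->]|ux].
    by case: w wA => [[v|v]|]; rewrite inE // => _; exact: (valP v).
  by exists (Some (inl (Sub u ux))); rewrite ?inE.
- move=> [[u|u]|] [[v|v]|] //=; rewrite ?inE // => _ _ /val_inj -> //.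
- by move=> [[u|u]|] [[v|v]|] //=; rewrite ?inE // overlap_ltE.
Qed.

Lemma nle_upper : nle r upper_part = nb_linext (del y).
Proof.
pose h (u : O) : Q := if u is Some (inr v) then val v else y.
rewrite nb_linext_del -(@nle_imset _ _ r (fun u v : Q => (u < v)%O) h).
- congr nle; apply/setP=> u; rewrite !inE andbT.
  apply/imsetP/idP=> [[w wA ->]|ux].
    by case: w wA => [[v|v]|]; rewrite inE // => _; exact: (valP v).
  by exists (Some (inr (Sub u ux))); rewrite ?inE.
- move=> [[u|u]|] [[v|v]|] //=; rewrite ?inE // => _ _ /val_inj -> //.
- by move=> [[u|u]|] [[v|v]|] //=; rewrite ?inE // overlap_ltE.
Qed.

(** Sending the new point to [x] gives an isomorphism with the dual of [P]; minimality of [x]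
    matches the absence of lower elements above the new point. *)
Lemma nle_pt_lower : nle r (overlap_pt x y |: lower_part) = nb_linext P.
Proof.
pose h (u : O) : P := if u is Some (inl v) then val v else x.
rewrite nb_linextE -(nle_dual _ (@ltxx _ P)).
rewrite -(@nle_imset _ _ r (fun u v : P => (v < u)%O) h).
- congr nle; apply/setP=> u; rewrite !inE; apply/imsetP.
  have [->|ux] := eqVneq u x; first by exists (overlap_pt x y); rewrite ?inE ?eqxx.
  by exists (Some (inl (Sub u ux))); rewrite ?inE.
- move=> [[u|u]|] [[v|v]|] //=; rewrite ?inE // => _ _.
  + by move=> /val_inj->.
  + by move=> ux; have := valP u; rewrite /= ux eqxx.
  + by move=> xv; have := valP v; rewrite /= -xv eqxx.
- move=> [[u|u]|] [[v|v]|] //=; rewrite ?inE // => _ _.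
  + by rewrite overlap_ltE.
  + by rewrite overlap_ltE.
  + by rewrite overlap_ltE gt_x.
  + by rewrite !ltxx.
Qed.

Lemma nle_pt_upper : nle r (overlap_pt x y |: upper_part) = nb_linext Q.
Proof.
pose h (u : O) : Q := if u is Some (inr v) then val v else y.
rewrite nb_linextE -(@nle_imset _ _ r (fun u v : Q => (u < v)%O) h).
- congr nle; apply/setP=> u; rewrite !inE; apply/imsetP.
  have [->|ux] := eqVneq u y; first by exists (overlap_pt x y); rewrite ?inE ?eqxx.
  by exists (Some (inr (Sub u ux))); rewrite ?inE.
- move=> [[u|u]|] [[v|v]|] //=; rewrite ?inE // => _ _.
  + by move=> /val_inj->.
  + by move=> ux; have := valP u; rewrite /= ux eqxx.
  + by move=> xv; have := valP v; rewrite /= -xv eqxx.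
- move=> [[u|u]|] [[v|v]|] //=; rewrite ?inE // => _ _.
  + by rewrite overlap_ltE.
  + by rewrite overlap_ltE gt_y.
  + by rewrite overlap_ltE.
  + by rewrite !ltxx.
Qed.

Lemma lower_lt_upper a b : a \in lower_part -> b \in upper_part -> (a < b)%O.
Proof. by case: a b => [[u|u]|] [[v|v]|]; rewrite ?inE // overlap_ltE. Qed.

Local Open Scope ring_scope.

(** Deleting the new point leaves an ordinal sum, with e(P - x) e(Q - y) linear extensions; the
    formula is [nle_overlap] divided by this product. *)
Lemma rho_overlap : rho (overlap_pt x y) = rho x + rho y - 1.
Proof.
have irr : irreflexive r by move=> u; apply: ltxx.
have tr : transitive r by apply: lt_trans.
have del_pt : nb_linext (del (overlap_pt x y)) = (nb_linext (del x) * nb_linext (del y))%N.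
  rewrite nb_linext_del overlap_setT setU1K; last by rewrite !inE.
  by rewrite (nle_ordsum irr tr lower_lt_upper) nle_lower nle_upper.
have zL a : a \in lower_part -> ~~ r (overlap_pt x y) a.
  by case: a => [[u|u]|]; rewrite inE // overlap_ltE.
have zU a : a \in upper_part -> ~~ r a (overlap_pt x y).
  by case: a => [[u|u]|]; rewrite inE // overlap_ltE.
have zNL : overlap_pt x y \notin lower_part by rewrite inE.
have zNU : overlap_pt x y \notin upper_part by rewrite inE.
have := nle_overlap irr tr lower_lt_upper zL zU zNL zNU.
rewrite -overlap_setT -nb_linextE nle_lower nle_upper nle_pt_lower nle_pt_upper.
move/(congr1 (GRing.natmul (1 : rat))); rewrite !natrD !natrM => /(canRL (addrK _)) eO.
have := @nb_linext_gt0 _ (del x); have := @nb_linext_gt0 _ (del y).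
rewrite -!(ltr0n rat) /rho del_pt natrM eO => /lt0r_neq0 y0 /lt0r_neq0 x0.
by field; rewrite x0 y0.
Qed.

End OverlapRho.

(** * Blocks *)

Section Stem.
Variables (d : Order.disp_t) (P : finPOrderType d) (x : P).

(** The phantom argument records [x] in the type, so that an order depending on [x] can be attached
    to it. *)
Definition stem (_ : P) : Type := option P.

HB.instance Definition _ := Finite.on (stem x).

(* [~~ (v <= x)] means [v != x] when x is minimal, but gives a transitive
   relation for every x. *)
Definition stem_le : rel (stem x) := fun u v =>
  match u, v with
  | None, None => true
  | None, Some v => ~~ (v <= x)%O
  | Some u, Some v => (u <= v)%O
  | Some _, None => false
  end.

Lemma stem_le_refl : reflexive stem_le.
Proof. by case=> [u|] /=. Qed.

Lemma stem_le_anti : antisymmetric stem_le.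
Proof. by case=> [u|] [v|] //=; rewrite ?andbF // => /le_anti->. Qed.

Lemma stem_le_trans : transitive stem_le.
Proof.
case=> [v|] [u|] [w|] //=; first exact: le_trans.
by move=> nvx vw; apply: contra nvx; apply: le_trans.
Qed.

HB.instance Definition _ := Order.Le_isPOrder.Build d (stem x)
  stem_le_refl stem_le_anti stem_le_trans.

Definition stem_bottom : stem x := None.
Definition stem_elt (u : P) : stem x := Some u.

Local Notation r := (fun u v : stem x => (u < v)%O).

Hypothesis xmin : x \in Min P.

Let gt_x u : (u < x)%O = false.
Proof. by move: xmin; rewrite inE => /forallP/(_ u)/negbTE. Qed.

Lemma stem_lt_elt u v : (stem_elt u < stem_elt v)%O = (u < v)%O.
Proof. by rewrite !lt_def. Qed.

Lemma stem_lt_bottom u : (u < stem_bottom)%O = false.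
Proof. by rewrite lt_def; case: u => [u|]. Qed.

Lemma stem_bottom_lt u : (stem_bottom < stem_elt u)%O = (u != x).
Proof.
rewrite lt_def (_ : (_ <= _)%O = ~~ (u <= x)%O) //=.
by rewrite le_eqVlt gt_x orbF.
Qed.

Let r_irr : irreflexive r. Proof. by move=> u; apply: ltxx. Qed.
Let r_trans : transitive r. Proof. exact: lt_trans. Qed.

Let nle_elt (A : {set P}) : nle r (stem_elt @: A) = nle (fun u v : P => (u < v)%O) A.
Proof.
apply: nle_imset => [u v _ _ [] //|u v _ _]; exact: stem_lt_elt.
Qed.

Let setTE : [set: stem x] = stem_bottom |: stem_elt @: [set: P].
Proof.
apply/setP=> -[u|]; rewrite !inE //; apply/esym/imsetP.
by exists u; rewrite ?inE.
Qed.

Let bottomN (A : {set P}) : stem_bottom \notin stem_elt @: A.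
Proof. by apply/imsetP=> -[]. Qed.

Let setD_elt : (stem_elt @: [set: P]) :\ stem_elt x = stem_elt @: ([set: P] :\ x).
Proof.
have elt_inj : injective stem_elt by move=> u v [].
apply/setP=> -[u|]; last first.
  by rewrite !inE (negPf (bottomN _)) (negPf (bottomN _)).
rewrite -/(stem_elt u) !inE !(mem_imset _ _ elt_inj) !inE.
by rewrite (inj_eq elt_inj).
Qed.

Lemma nb_linext_stem : nb_linext (stem x) = nb_linext P + nb_linext (del x).
Proof.
rewrite nb_linextE setTE (nle_add_bottom r_irr r_trans (x := stem_elt x)).
- by rewrite setD_elt !nle_elt nb_linextE nb_linext_del.
- apply/minsetP; split; first by rewrite imset_f ?inE.
  by move=> _ /imsetP[u _ ->]; rewrite stem_lt_elt gt_x.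
- by move=> _ /imsetP[u _ ->]; rewrite stem_bottom_lt.
- by move=> u _; rewrite stem_lt_bottom.
- exact: bottomN.
Qed.

Lemma nb_linext_del_bottom : nb_linext (del stem_bottom) = nb_linext P.
Proof. by rewrite nb_linext_del setTE setU1K ?bottomN // nle_elt nb_linextE. Qed.

(** Once [x] is gone the new element lies below all the others and contributes a factor 1. *)
Lemma nb_linext_del_elt : nb_linext (del (stem_elt x)) = nb_linext (del x).
Proof.
rewrite nb_linext_del setTE setDUl setD_elt.
have -> : [set stem_bottom] :\ stem_elt x = [set stem_bottom].
  by apply/setDidPl; rewrite disjoints1 inE.
rewrite (nle_ordsum r_irr r_trans) ?nle1 // ?mul1n ?nle_elt ?nb_linext_del //.
by move=> _ _ /set1P-> /imsetP[u /setD1P[ux _] ->]; rewrite stem_bottom_lt.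
Qed.

Lemma stem_bottom_min : stem_bottom \in Min (stem x).
Proof. by rewrite inE; apply/forallP=> u; rewrite stem_lt_bottom. Qed.

Lemma stem_elt_min : stem_elt x \in Min (stem x).
Proof.
rewrite inE; apply/forallP=> -[u|]; first by rewrite stem_lt_elt gt_x.
by rewrite stem_bottom_lt eqxx.
Qed.

Lemma card_stem : #|{: stem x}| = #|P|.+1.
Proof. exact: card_option. Qed.

Local Open Scope ring_scope.

Lemma rho_stem_elt : rho (stem_elt x) = rho x + 1.
Proof.
have := @nb_linext_gt0 _ (del x); rewrite -(ltr0n rat) => /lt0r_neq0 x0.
by rewrite /rho nb_linext_stem nb_linext_del_elt natrD mulrDl divff.
Qed.

Lemma rho_stem_bottom : rho stem_bottom = 1 + (rho x)^-1.
Proof.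
have := nb_linext_gt0 P; rewrite -(ltr0n rat) => /lt0r_neq0 P0.
by rewrite /rho nb_linext_stem nb_linext_del_bottom natrD mulrDl divff // invf_div.
Qed.

End Stem.

(** * Realizing rationals along their continued fractions *)

Section Blocks.
Local Open Scope ring_scope.

(** Unlike [realized], this keeps [x] minimal, as every stem step requires and restores, and only
    bounds the size. *)
Definition realizes (q : rat) (n : nat) : Prop :=
  exists (d : Order.disp_t) (P : finPOrderType d) (x : P),
    [/\ x \in Min P, rho x = q & (#|P| <= n)%N].

Lemma realizes1 : realizes 1 1.
Proof.
exists _, 'I_1, ord0.
have irr : irreflexive (fun u v : 'I_1 => (u < v)%O) by move=> u; apply: ltxx.
have T1 : [set: 'I_1] = [set ord0] by apply/setP=> u; rewrite !inE (ord1 u) eqxx.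
split; last by rewrite card_ord.
  by rewrite inE; apply/forallP=> u; rewrite (ord1 u) ltxx.
rewrite /rho nb_linext_del nb_linextE T1 setDv nle0 (nle1 irr) //.
Qed.

Lemma realizesS q n : realizes q n -> realizes (q + 1) n.+1.
Proof.
case=> d [P [x [xm <- Pn]]]; exists d, (stem x), (stem_elt x x).
by split; [exact: stem_elt_min | exact: rho_stem_elt | rewrite card_stem].
Qed.

Lemma realizesV q n : realizes q n -> realizes (1 + q^-1) n.+1.
Proof.
case=> d [P [x [xm <- Pn]]]; exists d, (stem x), (stem_bottom x).
by split; [exact: stem_bottom_min | exact: rho_stem_bottom | rewrite card_stem].
Qed.

Lemma realizesD q n k : realizes q n -> realizes (q + k%:R) (n + k).
Proof.
elim: k => [|k IHk] qn; first by rewrite addr0 addn0.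
by rewrite -natr1 addrA addnS; apply/realizesS/IHk.
Qed.

Lemma denq_div_le (n d : int) : d != 0 -> (`|denq (n%:Q / d%:Q)| <= `|d|)%N.
Proof. by move=> d0; have <- := fracqE (n, d); rewrite den_fracq d0 /= leq_div.
Qed.

(** A step of Euclid's algorithm: the new denominator divides the remainder [N] of [numq q] modulo
    [denq q]. This is why the fuel in [s] suffices. *)
Lemma denq_frac_inv (q : rat) (a : nat) : a%:R < q -> q < a.+1%:R ->
  (`|denq (q - a%:R)^-1| < `|denq q|)%N.
Proof.
move=> aq qa; pose N := numq q - a%:Z * denq q.
have dq0 : (denq q)%:~R != 0 :> rat by rewrite intr_eq0 denq_neq0.
have NE : N%:~R = (q - a%:R) * (denq q)%:~R by rewrite rmorphB rmorphM /= mulrBl numqE.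
have dqgt0 : 0 < (denq q)%:~R :> rat by rewrite ltr0z denq_gt0.
have N0 : 0 < N by rewrite -(ltr0z rat) NE mulr_gt0 ?subr_gt0.
have -> : (q - a%:R)^-1 = (denq q)%:Q / N%:Q.
  by rewrite NE invfM mulrCA divff // mulr1.
apply: leq_ltn_trans (denq_div_le _ (lt0r_neq0 N0)) _.
have : N < denq q.
  by rewrite -(ltr_int rat) NE gtr_pMl // ltrBlDr nat1r.
have := denq_gt0 q; lia.
Qed.

(** Each partial quotient [a] costs [a] elements: one inversion step, or the one-point poset at the
    end, already gives integer part 1, and [a.-1] steps adding 1 follow. *)
Lemma realizes_cfrac n q : 1 <= q -> (`|denq q| <= n)%N ->
  realizes q (sumn (cfrac n q)).
Proof.
elim: n q => [|n IHn] q q1 dn.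
  by have := denq_gt0 q; lia.
rewrite /=; set a := Num.truncn q.
have /andP[aq qa] : a%:R <= q < a.+1%:R by rewrite truncn_itv ?(le_trans ler01).
have a1 : (0 < a)%N by rewrite truncn_gt0.
case: eqP => [qE|/eqP qNa] /=.
  have := realizesD a.-1 realizes1.
  by rewrite addn0 add1n prednK // nat1r prednK // -qE.
have {}aq : a%:R < q by rewrite lt_neqAle eq_sym qNa.
have r1 : 1 <= (q - a%:R)^-1.
  by rewrite invf_ge1 ?subr_gt0 // lerBlDr nat1r ltW.
have := realizesD a.-1 (realizesV (IHn _ r1 _)).
have -> : 1 + (q - a%:R)^-1^-1 + a.-1%:R = q.
  by rewrite invrK -{1}(prednK a1) -natr1; ring.
rewrite addSnnS prednK // addnC; apply.
rewrite -ltnS; apply: leq_trans dn; exact: denq_frac_inv.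
Qed.

Lemma s0 : s 0 = 0%N.
Proof. by rewrite /s /= truncn0. Qed.

(** The first partial quotient is 0, so the expansion continues with [q^-1]; the drop of the
    denominator pays for the unit of fuel spent. *)
Lemma s_inv (q : rat) : 0 < q < 1 ->
  exists2 n, (`|denq q^-1| <= n)%N & s q = sumn (cfrac n q^-1).
Proof.
case/andP=> q0 q1; rewrite /s.
have := @denq_frac_inv q 0; rewrite subr0 => /(_ q0 q1).
case: (`|denq q|)%N => // n dn; exists n => //=.
have -> : Num.truncn q = 0%N.
  by apply/truncn_def; rewrite ltW.
by rewrite gt_eqF // subr0.
Qed.

Lemma frac_itv (l c : nat) : (0 < l < c)%N -> 0 < (l%:R / c%:R : rat) < 1.
Proof.
case/andP=> l0 lc; have c0 := ltn_trans l0 lc.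
by rewrite divr_gt0 ?ltr0n //= ltr_pdivrMr ?ltr0n // mul1r ltr_nat.
Qed.

Lemma divn_le_s (l c : nat) : (0 < l < c)%N -> (c %/ l <= s (l%:R / c%:R))%N.
Proof.
(* Denominators are positive, so some fuel is left and the sum starts with the integer part of c /
   l. *)
move=> lc; have [[|n] dn ->] := s_inv (frac_itv lc).
  by have := denq_gt0 (l%:R / c%:R)^-1; move: dn; lia.
case/andP: lc => l0 _; rewrite invf_div /=; apply: leq_trans (leq_addr _ _).
rewrite truncn_ge_nat ?divr_ge0 // ler_pdivlMr ?ltr0n // -natrM ler_nat.
exact: leq_divM.
Qed.

(** For [m] positive, one inversion step applied to a block for b / m yields 1 + m / b, so the
    leading 1 and the inversion together cost a single element. *)
Lemma block_exists (m b : nat) : (m < b)%N ->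
  exists (d : Order.disp_t) (P : finPOrderType d) (x : P), is_block 1 m b x.
Proof.
move=> mb; suff [d [P [x [xm xq Pn]]]] : realizes (1 + m%:R / b%:R) (1 + s (m%:R / b%:R)).
  by exists d, P, x.
have [->|m0] := posnP m.
  by rewrite mul0r s0 addr0; exact: realizes1.
have mb01 : (0 < m < b)%N by rewrite m0.
have /andP[q0 q1] := frac_itv mb01.
have [n dn ->] := s_inv (frac_itv mb01).
rewrite -[X in 1 + X]invrK add1n; apply: realizesV; apply: realizes_cfrac => //.
by rewrite invf_ge1 // ltW.
Qed.

(** A realizable size gives a least one, so the default value of [xget] is not taken. *)
Lemma nu_le (c d n : nat) : realized c d n -> (nu c d <= n)%N.
Proof.
move=> cdn.
have ex : exists k, `[< realized c d k >] by exists n; apply/asboolP.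
have [k /asboolP kr kmin] := ex_minnP ex.
have kS : realized c d k /\ forall j, realized c d j -> (k <= j)%N.
  by split=> // j jr; apply: kmin; apply/asboolP.
rewrite /nu; case: xgetP => [j _ [_]|/(_ k)]; first exact.
by move/(_ kS).
Qed.
End Blocks.

(** * The overlap construction *)

Lemma admissibleP (c d : nat) : admissible (c, d) ->
  [/\ (0 < c)%N, (0 < d - c)%N, (d - c < c)%N & (d < 2 * c)%N].
Proof. by case=> /= c0 _ /andP[cd dc]; split; lia. Qed.

Section OverlapConstruction.
Variables (c d l : nat).
Local Open Scope ring_scope.

Lemma overlap_boundE :
  overlap_bound c d l = (1 + s (l%:R / c%:R) + s ((d - c - l)%:R / c%:R))%N.
Proof. rewrite /overlap_bound /block_bound; lia. Qed.

Hypotheses (cd : admissible (c, d)) (lh : (l <= d - c)%N).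

Lemma overlap_blocks d1 d2 (P : finPOrderType d1) (Q : finPOrderType d2)
    (x : P) (y : Q) : is_block 1 l c x -> is_block 1 (d - c - l) c y ->
  rho (overlap_pt x y) = d%:R / c%:R /\
  (#|{: overlap x y}| <= overlap_bound c d l)%N.
Proof.
have [c0 h0 hc dc] := admissibleP cd.
case=> xm xq Pn [ym yq Qn]; split; last first.
  by rewrite card_overlap /overlap_bound; apply: leq_sub2r; apply: leq_add.
have c0r : c%:R != 0 :> rat by rewrite pnatr_eq0 -lt0n.
rewrite rho_overlap // xq yq natrB // natrB; last by lia.
by field.
Qed.

Lemma nu_overlap_bound : (nu c d <= overlap_bound c d l)%N.
Proof.
have [c0 h0 hc dc] := admissibleP cd.
have [d1 [P [x xb]]] := block_exists (leq_ltn_trans lh hc).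
have [d2 [Q [y yb]]] := block_exists (leq_ltn_trans (leq_subr l (d - c)) hc).
have [Rr Rn] := overlap_blocks xb yb.
apply: leq_trans Rn; apply: nu_le.
by exists d1, (overlap x y), (overlap_pt x y).
Qed.

Lemma overlap_quotient_le :
  (c %/ (d - c) <= s (l%:R / c%:R) + s ((d - c - l)%:R / c%:R))%N.
Proof.
have [c0 h0 hc dc] := admissibleP cd.
have [l0|l0] := posnP l.
  rewrite l0 subn0 (leq_trans _ (leq_addl _ _)) // divn_le_s //.
  by rewrite h0.
apply: leq_trans (leq_addr _ _); apply: leq_trans (leq_div2l _ l0 lh) _.
by apply: divn_le_s; rewrite l0 (leq_ltn_trans lh).
Qed.

End OverlapConstruction.

(** * Asymptotic comparison of c / h with log c loglog c *)

Local Open Scope classical_set_scope.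

Section Asymptotics.
Variable R : realType.
Local Open Scope ring_scope.
Local Notation LL := (@log_loglog R).

Lemma ln_nat_ge (M : R) : exists N : nat, forall c : nat, (N <= c)%N -> M <= ln c%:R.
Proof.
exists (Num.truncn (expR M)).+1 => c Nc.
have eM : expR M < c%:R.
  by apply: lt_le_trans (truncnS_gt _) _; rewrite ler_nat.
by rewrite -[M]expRK ler_ln ?posrE ?expR_gt0 ?ltW // (lt_trans (expR_gt0 M)).
Qed.

(** The lower bound 2 serves to absorb d / c < 2 into a multiple of [LL c]; the factor 4 replaces
    [d] by [c], each logarithm growing at most twofold on [c, 2c]. *)
Lemma log_loglog_bounds : exists N : nat, forall c : nat, (N <= c)%N ->
  2 <= LL c /\ forall d : nat, (c <= d <= 2 * c)%N -> 0 <= LL d <= 4 * LL c.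
Proof.
(* This threshold ensures ln c >= 2 and ln (ln c) >= 1. *)
have [N HN] := ln_nat_ge (2 + expR 1).
exists (maxn N 2) => c; rewrite geq_max => /andP[/HN lnc c2].
have e1 := expR_gt0 (1 : R).
have c0 : (0 : R) < c%:R by rewrite ltr0n; lia.
have llc : 1 <= ln (ln c%:R : R).
  by rewrite -{1}(expRK 1) ler_ln ?posrE //; lra.
split; first by rewrite /log_loglog; nra.
move=> d /andP[cd dc].
have cdr : (c%:R : R) <= d%:R by rewrite ler_nat.
have d0 : (0 : R) < d%:R by exact: lt_le_trans cdr.
have ln2 : ln (2 : R) <= 1.
  by have := @le_ln1Dx R 1; rewrite -[1 + 1]/2; lra.
have lncd : ln (c%:R : R) <= ln d%:R by rewrite ler_ln ?posrE.
have lnd : ln (d%:R : R) <= 2 * ln c%:R.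
  have : ln (d%:R : R) <= ln (2 * c%:R).
    by rewrite ler_ln ?posrE ?mulr_gt0 // -natrM ler_nat.
  rewrite lnM ?posrE //; lra.
have llcd : ln (ln (c%:R : R)) <= ln (ln d%:R) by rewrite ler_ln ?posrE //; lra.
have lld : ln (ln (d%:R : R)) <= 2 * ln (ln c%:R).
  have : ln (ln (d%:R : R)) <= ln (2 * ln c%:R).
    by rewrite ler_ln ?posrE //; lra.
  by rewrite lnM ?posrE //; lra.
rewrite /log_loglog; apply/andP; split; first by nra.
rewrite -[leRHS]/(4 * (_ * _)).
have -> : 4 * (ln c%:R * ln (ln c%:R)) = (2 * ln c%:R) * (2 * ln (ln c%:R)) :> R by ring.
by apply: ler_pM => //; lra.
Qed.

Lemma certifies_gap (C : R) : exists2 K : R, 0 < K &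
  exists N : nat, forall c d : nat, admissible (c, d) -> (N <= c)%N ->
    certifies c d (d%:R / c%:R + C * LL d) ->
    0 < LL c /\ c%:R / (d - c)%:R < K * LL c.
Proof.
(* The 1 accounts for d / c < 2 <= [LL c], the rest for [C * LL d]. *)
exists (1 + 4 * `|C|); first by have := normr_ge0 C; lra.
have [N HN] := log_loglog_bounds; exists N => c d cd /HN[LLc LLd] [l lh].
have [c0 h0 hc dc] := admissibleP cd.
have c0r : (0 : R) < c%:R by rewrite ltr0n.
have h0r : (0 : R) < (d - c)%:R by rewrite ltr0n.
have /LLd/andP[LLd0 LLd4] : (c <= d <= 2 * c)%N by lia.
have dc2 : d%:R / c%:R < 2 :> R by rewrite ltr_pdivrMr // -natrM ltr_nat.
have CLL : C * LL d <= `|C| * (4 * LL c).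
  apply: le_trans (ler_norm _) _; rewrite normrM (ger0_norm LLd0).
  by rewrite ler_wpM2l.
(* The summand 1 of the certified bound makes up for the floor in c / h. *)
have quo : c%:R / (d - c)%:R < (overlap_bound c d l)%:R :> R.
  rewrite ltr_pdivrMr // -natrM ltr_nat overlap_boundE.
  apply: leq_trans (ltn_ceil c h0) _; rewrite leq_mul2r -addnA add1n ltnS.
  by rewrite (overlap_quotient_le cd lh) orbT.
move=> cert; split; first by lra.
have := lt_le_trans quo cert; lra.
Qed.

Lemma gap_Omega_of_certifies (S : set (nat * nat)) : S `<=` admissible ->
  certifies_O R S -> gap_Omega R S.
Proof.
move=> Sadm [C [N HC]]; have [K K0 [N' HK]] := certifies_gap C.
exists K^-1; first by rewrite invr_gt0.
exists (maxn N N') => c d Scd; rewrite geq_max => /andP[Nc N'c].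
have [c0 h0 hc dc] := admissibleP (Sadm _ Scd).
have [|LL0] := HK _ _ (Sadm _ Scd) N'c (HC _ _ Scd _); first by lia.
have h0r : (0 : R) < (d - c)%:R by rewrite ltr0n.
rewrite ltr_pdivrMr // => /ltW cK.
rewrite mulrC ler_pdivrMr // ler_pdivrMr //; apply: le_trans cK _.
by rewrite le_eqVlt; apply/orP; left; apply/eqP; ring.
Qed.

(** Taking 1 / K for the constant in [gap_o] gives c / h >= K [LL c], against the strict inequality
    of [certifies_gap]. *)
Lemma gap_o_not_certifies (S : set (nat * nat)) (C : R) : S `<=` admissible ->
  gap_o R S -> exists N : nat, forall c d : nat, S (c, d) -> (N <= d)%N ->
    ~ certifies c d (d%:R / c%:R + C * LL d).
Proof.
move=> Sadm gap; have [K K0 [N' HK]] := certifies_gap C.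
have [|N HN] := gap K^-1; first by rewrite invr_gt0.
(* Doubling turns a lower bound on [d] into one on [c], as d < 2c. *)
exists (2 * maxn N N')%N => c d Scd Nd.
have [c0 h0 hc dc] := admissibleP (Sadm _ Scd).
have /andP[Nc N'c] : (N <= c)%N && (N' <= c)%N by rewrite -geq_max; lia.
case/(HK _ _ (Sadm _ Scd) N'c) => LL0.
have h0r : (0 : R) < (d - c)%:R by rewrite ltr0n.
have c0r : (0 : R) < c%:R by rewrite ltr0n.
have := HN _ _ Scd Nc.
rewrite -invfM -[_ / c%:R]invrK lef_pV2 ?posrE ?invr_gt0 ?divr_gt0 ?(mulr_gt0 K0 LL0) //.
by rewrite invf_div => /le_lt_trans h /h; rewrite ltxx.
Qed.

(** As c < d, only finitely many pairs have [d] below a given threshold, so an infinite [S] has a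
    pair beyond both thresholds. For a finite [S], [certifies_O] would hold vacuously. *)
Lemma gap_o_not_certifies_O (S : set (nat * nat)) : S `<=` admissible ->
  gap_o R S -> infinite_set S -> ~ certifies_O R S.
Proof.
move=> Sadm gap Sinf [C [N HC]].
have [N' HN'] := gap_o_not_certifies C Sadm gap.
apply: Sinf; set M := maxn N N'.
apply: (@sub_finite_set _ _ (`I_M `*` `I_M)); last by apply: finite_setX; apply: finite_II.
case=> c d Scd; have [c0 h0 hc dc] := admissibleP (Sadm _ Scd).
suff dM : (d < M)%N by split => //=; lia.
rewrite ltnNge; apply/negP; rewrite geq_max => /andP[Nd N'd].
exact: HN' Scd N'd (HC _ _ Scd Nd).
Qed.

(** With t = ln c, the left side is below t^2, while c = exp(t/3)^3 gives t^3 <= 27 c; it remains to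
    have k t > 27. *)
Lemma log_loglog_small (k : R) : 0 < k -> exists N : nat, forall c : nat,
  (N <= c)%N -> LL c < k * c%:R.
Proof.
move=> k0; have [N HN] := ln_nat_ge (1 + 27 / k).
exists (maxn N 1) => c; rewrite geq_max => /andP[/HN lnc c1].
have c0 : (0 : R) < c%:R by rewrite ltr0n.
have k27 : 0 < 27 / k by rewrite divr_gt0.
set t := ln c%:R in lnc *.
have t0 : 0 < t by lra.
have cube : (t / 3) ^+ 3 <= c%:R.
  have -> : c%:R = expR (t / 3) ^+ 3.
    by rewrite -expRM_natl mulrC divfK ?pnatr_eq0 // /t lnK ?posrE.
  rewrite lerXn2r ?nnegrE ?expR_ge0 ?divr_ge0 ?(ltW t0) //.
  by have := expR_ge1Dx (t / 3); lra.
have lnt : ln t < t by exact: ln_sublinear.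
have kt : 27 < k * t by rewrite mulrC -ltr_pdivrMr //; lra.
have cub : t ^+ 3 <= 27 * c%:R.
  have -> : t ^+ 3 = 27 * (t / 3) ^+ 3 by field.
  by rewrite ler_pM2l.
rewrite /log_loglog -/t; apply: lt_trans (_ : t * t < _); first by rewrite ltr_pM2l.
rewrite -(ltr_pM2r t0); apply: le_lt_trans (_ : 27 * c%:R < _).
  by apply: le_trans cub; rewrite !exprS expr0 mulr1 mulrA.
by rewrite mulrAC ltr_pM2r.
Qed.

Lemma admissible_succ (c : nat) : (1 < c)%N -> admissible (c, c.+1).
Proof. by move=> c1; split; rewrite /= ?coprimenS //; lia. Qed.

(** The pairs (c, c + 1) have h = 1, for which [gap_Omega] would force k c <= [LL c]. *)
Lemma admissible_not_certifies_O : ~ certifies_O R admissible.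
Proof.
move=> /gap_Omega_of_certifies[]// k k0 [N HN].
have [N' HN'] := log_loglog_small k0.
have [N2 LLpos] := log_loglog_bounds.
set c := maxn (maxn N N') (maxn N2 2).
have [Nc N'c N2c c2] : [/\ (N <= c)%N, (N' <= c)%N, (N2 <= c)%N & (2 <= c)%N].
  by rewrite /c; split; lia.
have := HN _ _ (admissible_succ c2) Nc; have [LL2 _] := LLpos _ N2c.
rewrite subSnn mulrA ler_pdivrMr; last by lra.
by rewrite mul1r leNgt HN'.
Qed.

End Asymptotics.

Local Open Scope ring_scope.

Theorem proposition1p3 (R : realType) :
  [/\
      (forall c d l : nat, admissible (c, d) -> (l <= d - c)%N ->
        let h := (d - c)%N in
        let sl := s (l%:R / c%:R) in
        let sr := s ((h - l)%:R / c%:R) in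
        [/\ (exists (d1 : Order.disp_t) (P : finPOrderType d1) (x : P),
               is_block 1 l c x) /\
            (exists (d2 : Order.disp_t) (Q : finPOrderType d2) (y : Q),
               is_block 1 (h - l) c y),
            (forall (d1 d2 : Order.disp_t) (P : finPOrderType d1)
               (Q : finPOrderType d2) (x : P) (y : Q),
               is_block 1 l c x -> is_block 1 (h - l) c y ->
               rho (overlap_pt x y) = d%:R / c%:R /\
               (#|{: overlap x y}| <= overlap_bound c d l)%N),
            overlap_bound c d l = (1 + sl + sr)%N,
            (nu c d <= overlap_bound c d l)%N
          & (c %/ h <= sl + sr)%N]),
      (forall S : set (nat * nat), S `<=` admissible ->
         certifies_O R S -> gap_Omega R S),
      (forall S : set (nat * nat), S `<=` admissible -> gap_o R S ->
         (forall C : R, exists N : nat, forall c d : nat,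
            S (c, d) -> (N <= d)%N ->
            ~ certifies c d (d%:R / c%:R + C * log_loglog R d)) /\
         (infinite_set S -> ~ certifies_O R S))
    & ~ certifies_O R admissible].
Proof.
split; first last.
- exact: admissible_not_certifies_O.
- move=> S Sadm gap; split; first by move=> C; apply: gap_o_not_certifies.
  exact: gap_o_not_certifies_O.
- exact: gap_Omega_of_certifies.
move=> c d l cd lh h sl sr; split.
- have [c0 h0 hc dc] := admissibleP cd.
  by split; apply: block_exists; [apply: leq_ltn_trans hc | apply: leq_ltn_trans (leq_subr _ _) hc].
- exact: overlap_blocks.
- exact: overlap_boundE.
- exact: nu_overlap_bound.
- exact: overlap_quotient_le.
Qed.
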